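(* Let $X$ be a separable complex Banach space, let $\Omega \subseteq X$ be a domain, and let $\mathcal{F} = \{f_\alpha\}_{\alpha \in \mathcal{A}}$ be a family of holomorphic functions $f_\alpha : \Omega \to \mathbb{C}$. Assume that there is a finite constant $M$ such that $|f_\alpha(z)| \leq M$ for all $f_\alpha \in \mathcal{F}$ and all $z \in \Omega$. Let $K$ be a compact subset of $\Omega$. Then every sequence in $\mathcal{F}$ has a subsequence that converges uniformly on $K$.
   Context: A domain $\Omega \subseteq X$ is a connected open set. For a function $u$ on $\Omega$, $q \in \Omega$ and $v \in X$, put $du(q;v) = \lim_{\mathbb{R} \ni \epsilon \to 0} \frac{u(q+\epsilon v) - u(q)}{\epsilon}$ and $\overline{D}u(q;v) = \frac{1}{2}\big(du(q;v) + i\, du(q; iv)\big)$. The function $u$ is $C^1$ if $du(q;v)$ exists for all $q \in \Omega$, $v \in X$ and $(q,v) \mapsto du(q;v)$ is continuous. A $C^1$ function $f$ on $\Omega$ is holomorphic if $\overline{D}f \equiv 0$ on $\Omega$ (equivalently, for $C^1$ functions, the restriction of $f$ to every complex line is holomorphic in the one-variable sense). *)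

(* Defs.v *)
From HB Require Import structures.
From mathcomp Require Import all_boot all_order all_algebra complex.
From mathcomp Require Import all_classical all_reals all_analysis.

Set Implicit Arguments.
Unset Strict Implicit.
Unset Printing Implicit Defensive.

Import Order.TTheory GRing.Theory Num.Theory.
Import numFieldNormedType.Exports.

Local Open Scope classical_set_scope.
Local Open Scope complex_scope.
Local Open Scope ring_scope.

(* The complex plane is R[i]; the alias R[i]^o is the same type, and is the one
   that carries the topology and the norm inherited from the modulus. *)

Definition separable_space (T : topologicalType) : Prop :=
  exists D : set T, countable D /\ dense D.

Definition domain (T : topologicalType) (Omega : set T) : Prop :=
  open Omega /\ connected Omega.

(* Functions on Omega are represented by total functions on X. Only the values
   on Omega matter below: when q is in the open set Omega, so is q + e v for
   every small enough real e. *)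

Definition real_diffquot (R : realType) (X : normedModType R[i])
    (u : X -> R[i]^o) (q v : X) (e : R) : R[i]^o :=
  (u (q + e%:C *: v) - u q) / e%:C.

(* [lim] is an unspecified value when there is no limit; [C1_on] requires the
   limits to exist. *)
Definition du (R : realType) (X : normedModType R[i])
    (u : X -> R[i]^o) (q v : X) : R[i]^o :=
  lim (real_diffquot u q v e @[e --> (0 : R)^']).

Definition Dbar (R : realType) (X : normedModType R[i])
    (u : X -> R[i]^o) (q v : X) : R[i]^o :=
  2^-1 * (du u q v + 'i%C * du u q ('i%C *: v)).

Definition C1_on (R : realType) (X : normedModType R[i])
    (Omega : set X) (u : X -> R[i]^o) : Prop :=
  (forall q v, Omega q -> cvg (real_diffquot u q v e @[e --> (0 : R)^'])) /\
  {within Omega `*` [set: X], continuous (fun p : X * X => du u p.1 p.2)}.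

Definition holomorphic_on (R : realType) (X : normedModType R[i])
    (Omega : set X) (u : X -> R[i]^o) : Prop :=
  C1_on Omega u /\ forall q v, Omega q -> Dbar u q v = 0.

(* Main.v *)
(* Equicontinuity comes from the Cauchy estimate |du(p; v)| <= M / rho, obtained on the
   disc p + zeta v without any integral: for G holomorphic on a disc and w a root of
   unity of order dividing n, w close to 1, put S(r) = sum_(j < n) w^-j G(r w^j). Comparing
   the increments of G in r with its increments under z |-> w z, which sum to zero
   over the orbit, shows that S(r) / r hardly varies with r. It is close to n G'(0) for
   small r, and is at most n M / rho for r = rho. Only the differentiability of G, uniform
   on the disc, is used.

   The limit function is the pointwise limit along a free ultrafilter on nat;
   equicontinuity makes the convergence uniform on K along the ultrafilter, whose
   members are infinite, so a subsequence can be read off. No diagonal argument over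
   a countable dense set is needed. *)

Require Import Defs.
From HB Require Import structures.
From mathcomp Require Import all_boot all_order all_algebra complex.
From mathcomp Require Import all_classical all_reals all_analysis.
From mathcomp Require Import ring lra.

Set Implicit Arguments.
Unset Strict Implicit.
Unset Printing Implicit Defensive.

Import Order.TTheory GRing.Theory Num.Theory.
Import numFieldNormedType.Exports.

Local Open Scope classical_set_scope.
Local Open Scope complex_scope.
Local Open Scope ring_scope.

(** * The complex modulus as a real-valued function *)

Section Modulus.
Context {R : realType}.
Implicit Types (z w : R[i]) (x y : R).
Notation normc := (@Normc.normc R).

(** The norm of [R[i]] takes its values in [R[i]]; with the real-valued [normc] the estimates become
    inequalities in [R]. *)
Lemma norm_normc z : `|z| = (normc z)%:C.
Proof. by case: z. Qed.

Lemma normc_ge0 z : 0 <= normc z.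
Proof. by case: z => a b; exact: sqrtr_ge0. Qed.

Lemma normc_real x : normc x%:C = `|x|.
Proof. by rewrite /= expr0n addr0 sqrtr_sqr. Qed.

Lemma normcX z n : normc (z ^+ n) = normc z ^+ n.
Proof.
elim: n => [|n IHn]; first by rewrite !expr0 Normc.normc1.
by rewrite !exprS Normc.normcM IHn.
Qed.

Lemma normc_dist z w : normc (z - w) = normc (w - z).
Proof. by rewrite -normcN opprB. Qed.

Lemma normc_sum (I : Type) (s : seq I) (P : pred I) (F : I -> R[i]) :
  normc (\sum_(i <- s | P i) F i) <= \sum_(i <- s | P i) normc (F i).
Proof.
elim/big_rec2: _ => [|i x z _ zx]; first by rewrite Normc.normc0.
by apply: le_trans (le_normcD _ _) _; rewrite lerD2l.
Qed.

Lemma normc_le_ReIm z : normc z <= `|complex.Re z| + `|complex.Im z|.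
Proof.
rewrite {1}[z]complexE; apply: le_trans (le_normcD _ _) _.
by rewrite Normc.normcM !normc_real /= expr0n add0r expr1n sqrtr1 mul1r.
Qed.

Lemma Re_le_normc z : `|complex.Re z| <= normc z.
Proof. by rewrite -lecR -norm_normc normc_ge_Re. Qed.

Lemma Im_le_normc z : `|complex.Im z| <= normc z.
Proof.
have -> : complex.Im z = complex.Re (- ('i%C * z)).
  by rewrite -mulrN mulrC ReiNIm raddfN opprK.
apply: le_trans (Re_le_normc _) _.
by rewrite normcN Normc.normcM /= expr0n add0r expr1n sqrtr1 mul1r.
Qed.

End Modulus.

(** * The Cauchy estimate on a disc, by discrete means over roots of unity *)

Section CauchyEstimate.
Context {R : realType}.
Implicit Types (z w : R[i]) (x y r : R).
Local Notation normc := (@Normc.normc R).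

Lemma root_of_unity_near1 (e : R) : 0 < e ->
  exists w n, [/\ (0 < n)%N, w ^+ n = 1, w != 1, normc w = 1 & normc (w - 1) < e].
Proof.
move=> e0; pose cis t := (cos t +i* sin t)%C : R[i].
have cisX t n : cis t ^+ n = cis (n%:R * t).
  elim: n => [|n IHn]; first by rewrite expr0 mul0r /cis cos0 sin0.
  rewrite exprS IHn -[in RHS]natr1 mulrDl mul1r addrC /cis cosD sinD.
  by apply/eqP; rewrite eq_complex /=; apply/andP; split; apply/eqP; ring.
have near0 : \forall t \near (0 : R), normc (cis t - 1) < e.
  have c1 : cos t @[t --> (0 : R)] --> (1 : R).
    by rewrite -[X in _ --> X](@cos0 R); exact: continuous_cos.
  have s0 : sin t @[t --> (0 : R)] --> (0 : R).
    by rewrite -[X in _ --> X](@sin0 R); exact: continuous_sin.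
  have e20 : 0 < e / 2 by rewrite divr_gt0.
  move/cvgrPdist_lt: c1 => /(_ _ e20) c1.
  move/cvgrPdist_lt: s0 => /(_ _ e20) s0.
  near=> t.
  apply: le_lt_trans (normc_le_ReIm _) _.
  rewrite [ltRHS](splitr e) ltrD //= ?oppr0 ?addr0.
    by rewrite distrC; near: t.
  by rewrite -[X in `|X|]opprK normrN -[X in `|X|]add0r; near: t.
have [d /= d0 dP] := near0.
have [n nd] : exists n : nat, 2 * pi / n.+1%:R < d.
  exists (Num.truncn (2 * pi / d)).
  have := truncnS_gt (2 * pi / d).
  by rewrite ltr_pdivrMr // => h; rewrite ltr_pdivrMr // [ltRHS]mulrC.
(* With at least two points the angle lies in []0, pi]], where [cos] is injective; hence
   [w != 1]. *)
exists (cis (2 * pi / n.+3%:R)), n.+3.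
have pi0 := @pi_gt0 R.
split => //.
- rewrite cisX mulrC divfK ?pnatr_eq0 // mulr_natl /cis cos2pi.
  by rewrite -[pi *+ 2]add0r sinD2pi sin0.
- apply/eqP => -[/= /eqP].
  rewrite -[X in _ == X](@cos0 R) => /eqP /cos_inj E _.
  have t0 : 0 < 2 * pi / n.+3%:R :> R by rewrite divr_gt0 // mulr_gt0.
  move: (t0); rewrite E ?ltxx // !in_itv /= ?lexx ?pi_ge0 // ltW //=.
  by rewrite ler_pdivrMr // mulrC ler_pM2l // ler_nat.
- by rewrite /= cos2Dsin2 sqrtr1.
- apply: dP; rewrite /= sub0r normrN ger0_norm; last first.
    by rewrite divr_ge0 // mulr_ge0 // pi_ge0.
  apply: le_lt_trans nd.
  by rewrite ler_pM2l ?mulr_gt0 // lef_pV2 ?posrE ?ltr0n // ler_nat ltnS -addn2 leq_addr.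
Unshelve. all: by end_near.
Qed.

(** Advance by steps of length [d / 2], strictly below [d], and add up; the induction is on the
    number of steps. *)
Lemma local_to_global_lipschitz (phi : R -> R[i]) (a b d L : R) :
  0 < d -> a <= b ->
  (forall x y, a <= x -> x <= y -> y <= b -> y - x < d ->
    normc (phi y - phi x) <= L * (y - x)) ->
  normc (phi b - phi a) <= L * (b - a).
Proof.
move=> d0 ab loc.
suff H n : forall x y, a <= x -> x <= y -> y <= b -> y - x <= n%:R * (d / 2) ->
    normc (phi y - phi x) <= L * (y - x).
  apply: (H (Num.truncn ((b - a) / (d / 2))).+1) => //.
  by rewrite -ler_pdivrMr ?divr_gt0 // ltW // truncnS_gt.
elim: n => [|n IHn] x y ax xy yb.
  rewrite mul0r subr_le0 => yx; have -> : y = x by apply/le_anti; rewrite yx xy.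
  by rewrite !subrr Normc.normc0 mulr0.
case: (ltP (y - x) d) => [yxd _|dyx]; first exact: loc.
rewrite -natr1 mulrDl mul1r => yxn.
have -> : phi y - phi x = (phi y - phi (x + d / 2)) + (phi (x + d / 2) - phi x).
  by rewrite addrA subrK.
apply: le_trans (le_normcD _ _) _.
have -> : L * (y - x) = L * (y - (x + d / 2)) + L * (x + d / 2 - x) by ring.
by apply: lerD; [apply: IHn|apply: loc]; lra.
Qed.

Section DiscreteMean.
Variables (G D : R[i] -> R[i]) (w : R[i]) (n : nat).
Hypotheses (wn : w ^+ n = 1) (w1 : w != 1) (nw : normc w = 1).

Let w0 : w != 0.
Proof.
by apply/eqP => E; move: nw (oner_eq0 R); rewrite E Normc.normc0 => ->; rewrite eqxx.
Qed.

Let normcwV j : normc (w ^- j) = 1.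
Proof. by rewrite Normc.normcV normcX nw expr1n invr1. Qed.

(* n times the mean of [G(z) / (z / |z|)] over n equidistant points of the circle [|z| = r]. *)
Definition circle_sum r : R[i] := \sum_(j < n) w ^- j * G (r%:C * w ^+ j).

(** A geometric sum whose ratio [w^-1] is not 1. It makes additive constants in [G] drop out of
    [circle_sum]. *)
Lemma sum_roots0 : \sum_(j < n) w ^- j = 0.
Proof.
under eq_bigr do rewrite -exprVn.
have /eqP := subrX1 w^-1 n.
rewrite exprVn wn invr1 subrr eq_sym mulf_eq0 subr_eq0 => /orP[/eqP E|/eqP //].
by case/eqP: w1; rewrite -[w]invrK E invr1.
Qed.

(** Telescoping. Applied to the terms of [circle_sum], it expresses invariance under rotation by
    [w]. *)
Lemma sum_shift (a : nat -> R[i]) : a n = a 0%N ->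
  \sum_(j < n) a j.+1 = \sum_(j < n) a j.
Proof.
move=> an; apply/eqP; rewrite -subr_eq0 -sumrB.
by rewrite -(big_mkord xpredT (fun j => a j.+1 - a j)) telescope_sumr // an subrr.
Qed.

(** Uniform differentiability of [G] on the closed disc of radius [rho], at one precision [eta] with
    its modulus [delta]; [D] stands for the derivative. *)
Definition linear_error eta delta rho := forall z z',
  normc z <= rho -> normc z' <= rho -> normc (z' - z) < delta ->
  normc (G z' - G z - (z' - z) * D z) <= eta * normc (z' - z).

(** Expand [G] at 0: the constant term vanishes by [sum_roots0], the linear term gives [n r D(0)],
    and each of the [n] errors is at most [eta r]. *)
Lemma circle_sum_small eta delta rho r : linear_error eta delta rho ->
  0 < r -> r <= rho -> r < delta ->
  normc (circle_sum r / r%:C - n%:R * D 0) <= n%:R * eta.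
Proof.
move=> GD r0 rrho rdelta.
have rC0 : r%:C != 0 :> R[i] by rewrite (inj_eq (@complexI R)) gt_eqF.
have nr j : normc (r%:C * w ^+ j) = r.
  by rewrite Normc.normcM normc_real normcX nw expr1n mulr1 gtr0_norm.
have E : circle_sum r / r%:C - n%:R * D 0 = r%:C^-1 *
    \sum_(j < n) w ^- j * (G (r%:C * w ^+ j) - G 0 - (r%:C * w ^+ j - 0) * D 0).
  apply: (mulfI rC0); rewrite mulrA divff // mul1r mulrBr mulrC divfK //.
  transitivity (circle_sum r - r%:C * (n%:R * D 0) - G 0 * \sum_(j < n) w ^- j).
    by rewrite sum_roots0 mulr0 subr0.
  rewrite /circle_sum mulr_sumr.
  have -> : r%:C * (n%:R * D 0) = \sum_(j < n) (r%:C * D 0).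
    by rewrite sumr_const card_ord -mulrnAr mulr_natl.
  rewrite -!sumrB; apply: eq_bigr => j _; rewrite subr0.
  have := expf_neq0 j w0; move: (w ^+ j) => v v0; field; exact: v0.
rewrite E Normc.normcM Normc.normcV normc_real gtr0_norm // mulrC ler_pdivrMr //.
apply: le_trans (normc_sum _ _ _) _.
have -> : n%:R * eta * r = \sum_(j < n) eta * r.
  by rewrite sumr_const card_ord mulr_natl mulrnAl.
apply: ler_sum => j _; rewrite Normc.normcM normcwV mul1r.
by apply: le_trans (GD _ _ _ _ _) _; rewrite ?Normc.normc0 ?subr0 ?nr //; lra.
Qed.

(* The derivative sum SD controls both the radial increment of [circle_sum] and, by
   invariance of the sum under rotation by w, [circle_sum] itself. *)
Lemma circle_sum_lipschitz eta delta rho r r' : linear_error eta delta rho ->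
  normc (w - 1) * rho < delta -> 0 < r -> r <= r' -> r' <= rho -> r' - r < delta ->
  normc (circle_sum r' / r'%:C - circle_sum r / r%:C)
    <= n%:R * (2 * eta) * (r' - r) / r'.
Proof.
move=> GD wdelta r0 rr' r'rho r'r.
have r'0 : 0 < r' by lra.
have rC0 : r%:C != 0 :> R[i] by rewrite (inj_eq (@complexI R)) gt_eqF.
have r'C0 : r'%:C != 0 :> R[i] by rewrite (inj_eq (@complexI R)) gt_eqF.
have nr x j : 0 <= x -> normc (x%:C * w ^+ j) = x.
  by move=> x0; rewrite Normc.normcM normc_real normcX nw expr1n mulr1 ger0_norm.
pose SD := \sum_(j < n) D (r%:C * w ^+ j).
have const_sum x : n%:R * x = \sum_(j < n) x.
  by rewrite sumr_const card_ord mulr_natl.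
have radial : normc (circle_sum r' - circle_sum r - (r' - r)%:C * SD)
    <= n%:R * (eta * (r' - r)).
  rewrite /circle_sum /SD mulr_sumr -!sumrB const_sum.
  apply: le_trans (normc_sum _ _ _) _; apply: ler_sum => j _.
  have dz : r'%:C * w ^+ j - r%:C * w ^+ j = (r' - r)%:C * w ^+ j.
    by rewrite -mulrBl -rmorphB.
  have -> : w ^- j * G (r'%:C * w ^+ j) - w ^- j * G (r%:C * w ^+ j)
      - (r' - r)%:C * D (r%:C * w ^+ j)
    = w ^- j * (G (r'%:C * w ^+ j) - G (r%:C * w ^+ j)
      - (r'%:C * w ^+ j - r%:C * w ^+ j) * D (r%:C * w ^+ j)).
    rewrite dz; have := expf_neq0 j w0; move: (w ^+ j) => v v0; field; exact: v0.
  rewrite Normc.normcM normcwV mul1r.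
  apply: le_trans (GD _ _ _ _ _) _; rewrite ?dz ?nr //; lra.
(* After multiplication by [1 - w^-1] the difference is a sum of linearization errors between
   neighbours [r w^j] and [r w^(j+1)]. Each is at most [eta r |w - 1|], and [|1 - w^-1| = |w - 1|]
   cancels. *)
have angular : normc (circle_sum r - r%:C * SD) <= n%:R * (eta * r).
  have nw1 : 0 < normc (w - 1).
    rewrite lt_def normc_ge0 andbT; apply/eqP => /Normc.eq0_normc /eqP.
    by rewrite subr_eq0 (negbTE w1).
  have E : (1 - w^-1) * (circle_sum r - r%:C * SD) =
      \sum_(j < n) w ^- j.+1 * (G (r%:C * w ^+ j.+1) - G (r%:C * w ^+ j)
        - (r%:C * w ^+ j.+1 - r%:C * w ^+ j) * D (r%:C * w ^+ j)).
    have -> : (1 - w^-1) * (circle_sum r - r%:C * SD) =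
        \sum_(j < n) w ^- j.+1 * G (r%:C * w ^+ j.+1)
        - w^-1 * circle_sum r - (1 - w^-1) * (r%:C * SD).
      rewrite (sum_shift (a := fun j => w ^- j * G (r%:C * w ^+ j))).
        by rewrite -/(circle_sum r); ring.
      by rewrite wn expr0 invr1.
    rewrite /circle_sum /SD !mulr_sumr -!sumrB; apply: eq_bigr => j _.
    rewrite exprS; have := expf_neq0 j w0; move: (w ^+ j) => v v0.
    by field; rewrite v0 w0.
  have -> : circle_sum r - r%:C * SD =
      (1 - w^-1)^-1 * ((1 - w^-1) * (circle_sum r - r%:C * SD)).
    rewrite mulKf // subr_eq0; apply/eqP => E1; case/eqP: w1.
    by rewrite -[w]invrK -E1 invr1.
  rewrite E Normc.normcM Normc.normcV.
  have -> : normc (1 - w^-1) = normc (w - 1).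
    have -> : 1 - w^-1 = w ^- 1 * (w - 1) by rewrite expr1; field; exact: w0.
    by rewrite Normc.normcM normcwV mul1r.
  rewrite mulrC ler_pdivrMr // -mulrA const_sum.
  apply: le_trans (normc_sum _ _ _) _; apply: ler_sum => j _.
  rewrite Normc.normcM normcwV mul1r.
  have nz : normc (r%:C * w ^+ j.+1 - r%:C * w ^+ j) = r * normc (w - 1).
    have -> : r%:C * w ^+ j.+1 - r%:C * w ^+ j = r%:C * w ^+ j * (w - 1).
      by rewrite exprS; ring.
    by rewrite Normc.normcM nr // ltW.
  apply: le_trans (GD _ _ _ _ _) _; rewrite ?nz ?nr ?mulrA //; try lra.
  by apply: le_lt_trans wdelta; rewrite mulrC ler_pM2l //; lra.
(* In this combination of the radial and angular errors, [SD] cancels. *)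
have -> : circle_sum r' / r'%:C - circle_sum r / r%:C =
    (r%:C * r'%:C)^-1 * (r%:C * (circle_sum r' - circle_sum r - (r' - r)%:C * SD)
      - (r' - r)%:C * (circle_sum r - r%:C * SD)).
  by rewrite rmorphB; field; rewrite rC0 r'C0.
rewrite Normc.normcM Normc.normcV Normc.normcM !normc_real !gtr0_norm //.
rewrite mulrC ler_pdivrMr ?mulr_gt0 //.
apply: le_trans (le_normcD _ _) _.
rewrite normcN !Normc.normcM !normc_real (gtr0_norm r0) ger0_norm ?subr_ge0 //.
have -> : n%:R * (2 * eta) * (r' - r) / r' * (r * r') =
    r * (n%:R * (eta * (r' - r))) + (r' - r) * (n%:R * (eta * r)).
  by field; rewrite gt_eqF.
by apply: lerD; apply: ler_wpM2l => //; lra.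
Qed.

Lemma circle_sum_bound M rho : 0 < rho ->
  (forall z, normc z <= rho -> normc (G z) <= M) ->
  normc (circle_sum rho / rho%:C) <= n%:R * (M / rho).
Proof.
move=> rho0 GM.
rewrite Normc.normcM Normc.normcV normc_real gtr0_norm // mulrA ler_pM2r ?invr_gt0 //.
apply: le_trans (normc_sum _ _ _) _.
have -> : n%:R * M = \sum_(j < n) M by rewrite sumr_const card_ord mulr_natl.
apply: ler_sum => j _; rewrite Normc.normcM normcwV mul1r; apply: GM.
by rewrite Normc.normcM normc_real normcX nw expr1n mulr1 gtr0_norm.
Qed.

End DiscreteMean.

(** With S the circle sum, compare [n D(0)] with [S(r) / r] for a small [r], then [S(r) / r] with
    [S(rho) / rho], and bound the latter by [n M / rho]. *)
Lemma cauchy_estimate (G D : R[i] -> R[i]) M rho : 0 < rho ->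
  (forall eta, 0 < eta -> exists2 delta, 0 < delta & linear_error G D eta delta rho) ->
  (forall z, normc z <= rho -> normc (G z) <= M) ->
  normc (D 0) <= M / rho.
Proof.
move=> rho0 GD GM; apply/ler_addgt0Pr => e e0.
(* One third pays for the comparison at the small radius, two thirds for the passage from [r] to
   [rho]. *)
pose eta := e / 3; have eta0 : 0 < eta by rewrite divr_gt0.
have [d d0 GDd] := GD _ eta0.
pose r := Num.min rho (d / 2).
have r0 : 0 < r by rewrite lt_min rho0 divr_gt0.
have rrho : r <= rho by rewrite ge_min lexx.
have rd : r < d.
  have : r <= d / 2 by rewrite ge_min lexx orbT.
  lra.
(* The Lipschitz constant of [S(x) / x] on [[r, rho]] is [2 n eta' / r]; the factor [r / rho] makes
   the total change at most [2 n eta]. *)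
pose eta' := eta * r / rho.
have eta'0 : 0 < eta' by rewrite divr_gt0 // mulr_gt0.
have [d' d'0 GDd'] := GD _ eta'0.
(* The root is chosen last, so that neighbouring points on the circle of radius [rho] are less than
   [d'] apart. *)
have [w [n [n0 wn w1 nw wd]]] := root_of_unity_near1 (divr_gt0 d'0 rho0).
rewrite ltr_pdivlMr // in wd.
have small := circle_sum_small wn w1 nw GDd r0 rrho rd.
have big := circle_sum_bound n nw rho0 GM.
have mid : normc (circle_sum G w n rho / rho%:C - circle_sum G w n r / r%:C)
    <= n%:R * (2 * eta') / r * (rho - r).
  apply: (@local_to_global_lipschitz (fun x => circle_sum G w n x / x%:C) r rho d') => //.
  move=> x y rx xy yrho yx.
  have x0 : 0 < x by lra.
  apply: le_trans (circle_sum_lipschitz wn w1 nw GDd' wd x0 xy yrho yx) _.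
  rewrite [leLHS]mulrAC ler_wpM2r ?subr_ge0 // ler_wpM2l //.
    by rewrite mulr_ge0 // mulr_ge0 // ltW.
  by rewrite lef_pV2 ?posrE; lra.
have n0R : 0 < n%:R :> R by rewrite ltr0n.
rewrite -(ler_pM2l n0R).
have -> : n%:R * normc (D 0) = normc (n%:R * D 0).
  by rewrite Normc.normcM -[n%:R in RHS](rmorph_nat (real_complex R)) normc_real normr_nat.
pose A := circle_sum G w n rho / rho%:C; pose B := circle_sum G w n r / r%:C.
have -> : n%:R * D 0 = A - (A - B) - (B - n%:R * D 0) by ring.
apply: le_trans (le_normcD _ _) _; rewrite normcN.
have := le_normcD A (- (A - B)); rewrite normcN.
have -> : n%:R * (M / rho + e) = n%:R * (M / rho) + n%:R * (2 * eta) + n%:R * eta.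
  by rewrite /eta; field; rewrite gt_eqF.
have mid' : normc (A - B) <= n%:R * (2 * eta).
  apply: le_trans mid _; rewrite /eta'.
  have -> : n%:R * (2 * (eta * r / rho)) / r * (rho - r) =
      n%:R * (2 * eta) * ((rho - r) / rho).
    by field; rewrite !gt_eqF.
  rewrite -[leRHS]mulr1; apply: ler_wpM2l; first by rewrite !mulr_ge0 // ltW.
  by rewrite ler_pdivrMr //; lra.
by move: small big; rewrite -/A -/B; lra.
Qed.
End CauchyEstimate.

(** * Mean value inequalities for complex functions of a real variable *)

Section RealParameter.
Context {R : realType}.
Local Notation normc := (@Normc.normc R).

(** The mean value theorem needs real values, so it is applied to [L (F t - t c)]; [L] will be the
    real or the imaginary part. *)
Lemma mean_value_component (L : {additive R[i] -> R}) (F : R -> R[i]^o)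
    (d : R -> R[i]^o) (c : R[i]) (eta a b : R) :
  (forall z, `|L z| <= normc z) -> (forall x z, L (x%:C * z) = x * L z) ->
  a <= b ->
  (forall t, a <= t <= b -> (F (t + e) - F t) / e%:C @[e --> (0 : R)^'] --> d t) ->
  (forall t, a <= t <= b -> normc (d t - c) <= eta) ->
  `|L (F b - F a - (b - a)%:C * c)| <= eta * (b - a).
Proof.
move=> Ln LZ ab dF dc.
pose h t := L (F t - t%:C * c).
have dh t : a <= t <= b -> is_derive t 1 h (L (d t - c)).
  move=> tab.
  have cv : e^-1 *: ((h \o shift t) (e *: 1) - h t) @[e --> (0 : R)^'] --> L (d t - c).
    apply/cvgrPdist_lt => e e0.
    have eC : (0 : R[i]) < e%:C by rewrite ltcR.
    have /cvgrPdist_lt /(_ _ eC) := dF t tab.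
    apply: filter_app; near=> s.
    have s0 : s != 0 by near: s; exact: nbhs_dnbhs_neq.
    rewrite norm_normc ltcR => H.
    apply: le_lt_trans H; apply: le_trans (Ln _).
    rewrite /h /= /GRing.scale /= mulr1 -raddfB -LZ -raddfB.
    rewrite le_eqVlt; apply/orP; left; apply/eqP; congr (`|L _|).
    rewrite [s + t]addrC fmorphV rmorphD.
    have sC0 : s%:C != 0 :> R[i] by rewrite (inj_eq (@complexI R)).
    by field.
  split; first by apply/cvg_ex; exists (L (d t - c)).
  exact: (cvg_lim _ cv).
have [||x xab E] := @MVT_segment R h (fun t => L (d t - c)) a b ab.
- move=> x; rewrite in_itv /= => /andP[ax xb]; apply: dh; lra.
- apply: derivable_within_continuous => x; rewrite in_itv /= => xab.
  by have [] := dh x xab.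
- have -> : F b - F a - (b - a)%:C * c = (F b - b%:C * c) - (F a - a%:C * c).
    by rewrite rmorphB; ring.
  rewrite raddfB -/(h b) -/(h a) E normrM [X in _ * X]ger0_norm ?subr_ge0 //.
  rewrite ler_wpM2r ?subr_ge0 //; apply: le_trans (Ln _) _; apply: dc.
  by move: xab; rewrite in_itv.
Unshelve. all: by end_near.
Qed.

(** The factor 2 comes from bounding the modulus by the sum of the two components. *)
Lemma mean_value_complex (F : R -> R[i]^o) (d : R -> R[i]^o) (c : R[i]) (eta a b : R) :
  a <= b ->
  (forall t, a <= t <= b -> (F (t + e) - F t) / e%:C @[e --> (0 : R)^'] --> d t) ->
  (forall t, a <= t <= b -> normc (d t - c) <= eta) ->
  normc (F b - F a - (b - a)%:C * c) <= 2 * eta * (b - a).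
Proof.
move=> ab dF dc; apply: le_trans (normc_le_ReIm _) _.
rewrite -mulrA mulr_natl mulr2n; apply: lerD.
  apply: (@mean_value_component (@complex.Re R) F d) => //.
    exact: Re_le_normc.
  by move=> x [y z] /=; rewrite mul0r subr0.
apply: (@mean_value_component (@complex.Im R) F d) => //.
  exact: Im_le_normc.
by move=> x [y z] /=; rewrite mul0r addr0.
Qed.

Lemma mean_value_complex_minmax (F : R -> R[i]^o) (d : R -> R[i]^o) (c : R[i])
    (eta a b : R) :
  (forall t, Num.min a b <= t <= Num.max a b ->
    (F (t + e) - F t) / e%:C @[e --> (0 : R)^'] --> d t) ->
  (forall t, Num.min a b <= t <= Num.max a b -> normc (d t - c) <= eta) ->
  normc (F b - F a - (b - a)%:C * c) <= 2 * eta * `|b - a|.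
Proof.
case: (leP a b) => [ab|/ltW ba] dF dc.
  by rewrite ger0_norm ?subr_ge0 //; exact: (mean_value_complex ab dF dc).
rewrite distrC ger0_norm ?subr_ge0 // -normcN.
have -> : - (F b - F a - (b - a)%:C * c) = F a - F b - (a - b)%:C * c.
  by rewrite !rmorphB; ring.
exact: (mean_value_complex ba dF dc).
Qed.

End RealParameter.

(** * Holomorphic functions along complex lines *)

Section ComplexLine.
Context {R : realType} {X : normedModType R[i]}.
Variables (Omega : set X) (u : X -> R[i]^o).
Hypotheses (oOmega : open Omega) (hu : holomorphic_on Omega u).
Local Notation normc := (@Normc.normc R).
Implicit Types (p v : X).

Lemma du_cvg q v : Omega q -> real_diffquot u q v e @[e --> (0 : R)^'] --> du u q v.
Proof. by move=> qO; exact: hu.1.1. Qed.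

(** The Cauchy-Riemann equation [Dbar u q v = 0], solved for its second term. *)
Lemma du_i q v : Omega q -> du u q ('i%C *: v) = 'i%C * du u q v.
Proof.
move=> qO; have /eqP := hu.2 q v qO.
rewrite /Dbar mulf_eq0 invr_eq0 pnatr_eq0 /= addrC addr_eq0 => /eqP E.
apply: (@mulfI _ ('i%C)); first by rewrite eq_complex /= oner_eq0 andbF.
by rewrite E mulrA -expr2 sqr_i mulN1r.
Qed.

(** The direction [w] will be 1 on horizontal segments and ['i] on vertical ones. *)
Lemma du_line_cvg p v z w t : Omega (p + (z + t%:C * w) *: v) ->
  (u (p + (z + (t + e)%:C * w) *: v) - u (p + (z + t%:C * w) *: v)) / e%:C
    @[e --> (0 : R)^'] --> du u (p + (z + t%:C * w) *: v) (w *: v).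
Proof.
move=> /(@du_cvg _ (w *: v)).
set F := (X in X @ _ --> _ -> _); set F' := (X in _ -> X @ _ --> _).
suff -> : F = F' by [].
apply: funext => e; rewrite /F /F' /real_diffquot.
rewrite scalerA -addrA -scalerDl; congr ((u (p + _ *: v) - _) / _).
by rewrite rmorphD mulrDl addrA.
Qed.

Lemma continuous_du q v : Omega q -> {for q, continuous (du u ^~ v)}.
Proof.
move=> qO.
have oOX : open (Omega `*` [set: X]).
  rewrite (_ : Omega `*` _ = fst @^-1` Omega); last first.
    by apply/seteqP; split => [x []|x].
  by apply: open_comp => // x _; exact: cvg_fst.
have := hu.1.2; rewrite continuous_open_subspace // => /(_ (q, v)).
rewrite inE /= => /(_ (conj qO I)) c.
apply: (@continuous_comp _ _ _ (fun x => (x, v)) (fun p : X * X => du u p.1 p.2)) => //.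
by apply: cvg_pair; [exact: cvg_id|exact: cvg_cst].
Qed.

Lemma du_line_continuous p v z (e : R) : Omega (p + z *: v) -> 0 < e ->
  exists2 tau : R, 0 < tau & forall z', normc (z' - z) < tau ->
    normc (du u (p + z' *: v) v - du u (p + z *: v) v) < e.
Proof.
move=> zO e0; have eC : (0 : R[i]) < e%:C by rewrite ltcR.
have /cvgrPdist_lt /(_ _ eC) /nbhs_ballP[r /= r0 rP] := continuous_du (v := v) zO.
have /complex_realP[s rE] : r \is Num.real by exact: gtr0_real.
have /complex_realP[nv vE] : `|v| \is Num.real by exact: normr_real.
have s0 : 0 < s by move: r0; rewrite rE ltcR.
have nv0 : 0 <= nv by rewrite -ler0c -vE normr_ge0.
(* Adding 1 keeps the denominator positive when [v = 0]. *)
exists (s / (nv + 1)); first by rewrite divr_gt0 // ltr_wpDl.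
move=> z'; rewrite ltr_pdivlMr ?ltr_wpDl // => zz'.
rewrite normc_dist -ltcR -norm_normc; apply: rP.
rewrite -ball_normE /= opprD addrACA subrr add0r -scalerBl normrZ vE norm_normc rE.
rewrite -rmorphM ltcR normc_dist; apply: le_lt_trans zz'.
by rewrite ler_wpM2l ?normc_ge0 // lerDl.
Qed.

(** Compactness of the square [[-rho, rho]^2], which contains the disc of radius [rho] and lies in
    that of radius [2 rho]; hence the larger disc in the hypothesis. *)
Lemma du_line_unif_continuous p v (rho e : R) :
  (forall z, normc z <= 2 * rho -> Omega (p + z *: v)) -> 0 < e ->
  exists2 tau : R, 0 < tau & forall z z', normc z <= rho -> normc (z' - z) < tau ->
    normc (du u (p + z' *: v) v - du u (p + z *: v) v) <= e.
Proof.
move=> lineO e0.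
pose P (t : R) (x : R * R) := forall z', normc (z' - (x.1 +i* x.2)%C) < t ->
  normc (du u (p + z' *: v) v - du u (p + (x.1 +i* x.2)%C *: v) v) <= e.
have zE z : z = (complex.Re z +i* complex.Im z)%C :> R[i] by case: z.
have : \forall t \near (0 : R), `[- rho, rho] `*` `[- rho, rho] `<=` P t.
  have /compact_near_coveringP := compact_setX (@segment_compact R (- rho) rho)
    (@segment_compact R (- rho) rho).
  move=> /(_ R (nbhs (0 : R)) P _); apply => -[x y] /=; rewrite !in_itv /= => -[]; rewrite -!ler_norml => xrho yrho.
  have xyO : Omega (p + (x +i* y)%C *: v).
    by apply: lineO; apply: le_trans (normc_le_ReIm _) _ => /=; lra.
  have e20 : 0 < e / 2 by rewrite divr_gt0.
  have [tau tau0 tauP] := du_line_continuous xyO e20.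
  (* Two coordinates within [tau / 4] and [z'] within another [tau / 4] keep all points within [tau]
     of [x + i y]. *)
  have tau4 : 0 < tau / 4 by rewrite divr_gt0.
  exists (ball (x, y) (tau / 4), ball 0 (tau / 4)) => /=.
    by split; exact: nbhsx_ballx.
  move=> [[x' y'] t] /= [[/= xx' yy']]; rewrite /ball /= in xx' yy' *.
  rewrite sub0r normrN => tt' z' zt.
  have near_xy : normc ((x' +i* y')%C - (x +i* y)%C) < tau / 2.
    apply: le_lt_trans (normc_le_ReIm _) _ => /=.
    by rewrite [in X in X < _]distrC [`|y' - y|]distrC; lra.
  have := tauP _ (lt_trans near_xy _); move=> /(_ ltac:(lra)) H1.
  have zz' : normc (z' - (x +i* y)%C) < tau.
    have -> : z' - (x +i* y)%C =
      (z' - (x' +i* y')%C) + ((x' +i* y')%C - (x +i* y)%C) by ring.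
    apply: le_lt_trans (le_normcD _ _) _.
    by have := ler_norm t; rewrite /= in zt; lra.
  have H2 := tauP _ zz'.
  set a := du u (p + z' *: v) v in H2 *.
  set b := du u (p + (x' +i* y')%C *: v) v in H1 *.
  set c := du u (p + (x +i* y)%C *: v) v in H1 H2.
  have -> : a - b = (a - c) + (c - b) by ring.
  apply: le_trans (le_normcD _ _) _.
  by rewrite [normc (c - b)]normc_dist; lra.
move=> [d /= d0 dP]; exists (d / 2); first by rewrite divr_gt0.
move=> z z' zrho zz'.
have dd : ball_ [eta Num.Def.normr] 0 d (d / 2).
  by rewrite /= sub0r normrN ger0_norm; lra.
have := dP _ dd (complex.Re z, complex.Im z).
rewrite /P /= !in_itv /= -zE; apply => //.
have := Re_le_normc z; have := Im_le_normc z.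
by rewrite !ler_norml; split; lra.
Qed.

(* The increment from z to z' is split along a horizontal and a vertical segment, so that
   only derivatives in the directions v and i v occur. *)
Lemma du_line_linear_error p v (rho eta : R) :
  (forall z, normc z <= 2 * rho -> Omega (p + z *: v)) -> 0 < eta ->
  exists2 delta : R, 0 < delta &
    linear_error (fun z => u (p + z *: v)) (fun z => du u (p + z *: v) v) eta delta rho.
Proof.
(* Each of the two segments costs [2 (eta / 4)] times its length, and each length is at most [N],
   the distance from z to z'. *)
move=> lineO eta0; have eta4 : 0 < eta / 4 by rewrite divr_gt0.
have [tau tau0 unif] := du_line_unif_continuous lineO eta4.
(* Points of the rectangle spanned by z and z' are within [2 N < tau] of z. *)
exists (tau / 2); first by rewrite divr_gt0.
move=> [x y] [x' y'] zrho z'rho zz'.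
set c := du u (p + (x +i* y)%C *: v) v.
have lx : `|x| <= rho := le_trans (Re_le_normc _) zrho.
have ly : `|y| <= rho := le_trans (Im_le_normc _) zrho.
have lx' : `|x'| <= rho := le_trans (Re_le_normc _) z'rho.
have ly' : `|y'| <= rho := le_trans (Im_le_normc _) z'rho.
set N := normc (_ - _) in zz' *.
have dx : `|x' - x| <= N by exact: (Re_le_normc ((x' +i* y')%C - (x +i* y)%C)).
have dy : `|y' - y| <= N by exact: (Im_le_normc ((x' +i* y')%C - (x +i* y)%C)).
have near_z s t : `|s - x| <= `|x' - x| -> `|t - y| <= `|y' - y| ->
    normc (du u (p + (s +i* t)%C *: v) v - c) <= eta / 4.
  move=> sx ty; apply: unif => //.
  by apply: le_lt_trans (normc_le_ReIm _) _ => /=; lra.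
(* The corner [x' + i y] may leave the disc of radius [rho], but not that of radius [2 rho]. *)
have in_rect s t : `|s| <= rho -> `|t| <= rho -> Omega (p + (s +i* t)%C *: v).
  by move=> sr tr; apply: lineO; apply: le_trans (normc_le_ReIm _) _ => /=; lra.
have between (a b t : R) : Num.min a b <= t <= Num.max a b ->
    `|t - a| <= `|b - a| /\ forall r, `|a| <= r -> `|b| <= r -> `|t| <= r.
  rewrite minEle maxEle; case: (leP a b) => ab /andP[at_ tb].
    split; first by rewrite !ger0_norm; lra.
    by move=> r; rewrite !ler_norml; lra.
  split; first by rewrite !ler0_norm; lra.
  by move=> r; rewrite !ler_norml; lra.
have hE t : (t +i* y)%C = 'i%C * y%:C + t%:C * 1 :> R[i].
  by rewrite mulr1 addrC [LHS]complexE.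
have vE t : (x' +i* t)%C = x'%:C + t%:C * 'i%C :> R[i] by rewrite mulrC [LHS]complexE.
have horiz : normc (u (p + (x' +i* y)%C *: v) - u (p + (x +i* y)%C *: v)
    - (x' - x)%:C * c) <= 2 * (eta / 4) * `|x' - x|.
  apply: (@mean_value_complex_minmax _ (fun t => u (p + (t +i* y)%C *: v))
    (fun t => du u (p + (t +i* y)%C *: v) v)) => t /between[tx tr].
    under eq_fun do rewrite !hE.
    rewrite hE -[X in du u _ X]scale1r; apply: du_line_cvg.
    by rewrite -hE; apply: in_rect; [apply: tr|]; lra.
  by apply: near_z => //; rewrite subrr normr0.
have vert : normc (u (p + (x' +i* y')%C *: v) - u (p + (x' +i* y)%C *: v)
    - (y' - y)%:C * ('i%C * c)) <= 2 * (eta / 4) * `|y' - y|.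
  apply: (@mean_value_complex_minmax _ (fun t => u (p + (x' +i* t)%C *: v))
    (fun t => du u (p + (x' +i* t)%C *: v) ('i%C *: v))) => t /between[ty tr].
    under eq_fun do rewrite !vE.
    rewrite vE; apply: du_line_cvg.
    by rewrite -vE; apply: in_rect; [|apply: tr]; lra.
  rewrite du_i; last by apply: in_rect; [|apply: tr]; lra.
  rewrite -mulrBr Normc.normcM (_ : normc 'i%C = 1) ?mul1r; first exact: near_z.
  by rewrite /= expr0n add0r expr1n sqrtr1.
have -> : u (p + (x' +i* y')%C *: v) - u (p + (x +i* y)%C *: v)
    - ((x' +i* y')%C - (x +i* y)%C) * c =
  (u (p + (x' +i* y')%C *: v) - u (p + (x' +i* y)%C *: v) - (y' - y)%:C * ('i%C * c))
  + (u (p + (x' +i* y)%C *: v) - u (p + (x +i* y)%C *: v) - (x' - x)%:C * c).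
  have -> : (x' +i* y')%C - (x +i* y)%C = (x' - x)%:C + 'i%C * (y' - y)%:C :> R[i].
    by rewrite [LHS]complexE.
  set a := (y' - y)%:C; set b := (x' - x)%:C.
  by move: a b => a b; ring.
apply: le_trans (le_normcD _ _) _.
have : eta * (`|x' - x| + `|y' - y|) <= eta * (N + N) by rewrite ler_pM2l //; lra.
by move: horiz vert; lra.
Qed.

Lemma du_bound (M rho : R) p v : (forall z, Omega z -> `|u z| <= M%:C) -> 0 < rho ->
  (forall z, normc z <= 2 * rho -> Omega (p + z *: v)) ->
  normc (du u p v) <= M / rho.
Proof.
move=> uM rho0 lineO.
have := @cauchy_estimate R (fun z => u (p + z *: v)) (fun z => du u (p + z *: v) v)
  M rho rho0.
rewrite /= scale0r addr0; apply.
  by move=> eta eta0; exact: du_line_linear_error.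
by move=> z zrho; rewrite -lecR -norm_normc; apply/uM/lineO; lra.
Qed.

(** The derivative bound is used at every centre [q + t v] with [0 <= t <= 1]; moving the centre
    costs the extra 1 in the radius. *)
Lemma increment_bound (M rho : R) q v :
  (forall z, Omega z -> `|u z| <= M%:C) -> 0 < rho ->
  (forall z, normc z <= 2 * rho + 1 -> Omega (q + z *: v)) ->
  normc (u (q + v) - u q) <= 2 * (M / rho).
Proof.
move=> uM rho0 lineO.
have line t z : 0 <= t <= 1 -> normc z <= 2 * rho -> Omega (q + t%:C *: v + z *: v).
  move=> t01 zrho; rewrite -addrA -scalerDl; apply: lineO.
  apply: le_trans (le_normcD _ _) _.
  by rewrite normc_real ger0_norm; lra.
have := @mean_value_complex _ (fun t => u (q + t%:C *: v))
  (fun t => du u (q + t%:C *: v) v) 0 (M / rho) 0 1.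
rewrite scale1r scale0r addr0 subr0 mulr0 subr0 mulr1; apply => //.
  move=> t t01; have : Omega (q + (0 + t%:C * 1) *: v).
    rewrite add0r mulr1 -[q + _]addr0 -(scale0r v); apply: line => //.
    by rewrite Normc.normc0; lra.
  move/du_line_cvg; rewrite add0r mulr1 scale1r.
  by under eq_fun do rewrite add0r mulr1.
by move=> t t01; rewrite subr0; apply: du_bound => // z zrho; exact: line.
Qed.

End ComplexLine.

(** * Equicontinuity of uniformly bounded families *)

Lemma bounded_holomorphic_equicontinuous (R : realType) (X : normedModType R[i])
    (Omega : set X) (M : R) (q : X) (e : R) : open Omega -> Omega q -> 0 < e ->
  \forall y \near q, forall u : X -> R[i]^o, holomorphic_on Omega u ->
    (forall z, Omega z -> `|u z| <= M%:C) -> Normc.normc (u y - u q) <= e.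
Proof.
move=> oO qO e0.
have [r /= r0 rP] : nbhs_ball q Omega by rewrite nbhs_ballE; exact: open_nbhs_nbhs.
have /complex_realP[s rE] : r \is Num.real by exact: gtr0_real.
have s0 : 0 < s by move: r0; rewrite rE ltcR.
(* Chosen so that [2 (|M| + 1) / rho = e]; the 1 keeps [rho] positive when [M = 0]. *)
pose rho := 2 * (`|M| + 1) / e.
have M0 : 0 <= `|M| by exact: normr_ge0.
have rho0 : 0 < rho by rewrite divr_gt0 // mulr_gt0 // ltr_wpDl.
have k0 : 0 < 2 * rho + 1 by lra.
(* For [y] within this radius of [q], the disc of radius [2 rho + 1] in direction [y - q] stays in
   the ball of radius [s] inside [Omega], whatever [u] is. *)
have sk0 : 0 < (s / (2 * rho + 1))%:C :> R[i] by rewrite ltcR divr_gt0.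
near=> y => u hu uM.
have yq : `|q - y| < (s / (2 * rho + 1))%:C.
  by near: y; have := nbhsx_ballx q _ sk0; rewrite -ball_normE.
have yE : y = q + (y - q) by rewrite addrC subrK.
rewrite [X in u X - _]yE; apply: le_trans (increment_bound (M := M) (rho := rho) oO hu uM rho0 _) _.
  move=> z zrho; apply: rP; rewrite -ball_normE /= opprD addrA subrr add0r normrN.
  rewrite normrZ distrC rE.
  have /complex_realP[t tE] : `|q - y| \is Num.real by exact: normr_real.
  move: yq; rewrite tE norm_normc -rmorphM !ltcR ltr_pdivlMr // => ts.
  have t0 : 0 <= t by rewrite -ler0c -tE normr_ge0.
  by apply: le_lt_trans ts; rewrite mulrC ler_wpM2l.
have := ler_norm M.
have -> : e = 2 * ((`|M| + 1) / rho).
  by rewrite /rho; field; rewrite !gt_eqF // ltr_wpDl.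
by move=> MM; rewrite ler_pM2l // ler_pM2r ?invr_gt0 //; lra.
Unshelve. all: by end_near.
Qed.

(** * Limits along an ultrafilter and extraction of the subsequence *)

(** The image of an ultrafilter is an ultrafilter; it contains the compact segment [[-M, M]], so it
    converges. *)
Lemma ultra_bounded_cvg (R : realType) (T : Type) (U : set_system T) (h : T -> R) (M : R) :
  UltraFilter U -> (forall t, `|h t| <= M) -> exists l : R, h @ U --> l.
Proof.
move=> UU hM.
have Uh : UltraFilter (h @ U).
  split; first exact: fmap_proper_filter.
  move=> G GP hG; apply/seteqP; split => [B GB|]; last exact: hG.
  have [//|UBc] := in_ultra_setVsetC (h @^-1` B) UU.
  have GBc : G (~` B) by apply: hG.
  by have [x []] := filter_ex (filterI GB GBc).
have := @segment_compact R (- M) M; rewrite compact_ultra => /(_ _ Uh) [].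
  have : U (h @^-1` `[- M, M]%classic).
    by apply: filterE => t /=; rewrite in_itv /= -ler_norml.
  exact.
by move=> l [_ hl]; exists l.
Qed.

Lemma ultra_bounded_cvg_complex (R : realType) (T : Type) (U : set_system T)
    (h : T -> R[i]) (M : R) : UltraFilter U -> (forall t, Normc.normc (h t) <= M) ->
  exists l, forall e, 0 < e -> \forall t \near U, Normc.normc (h t - l) < e.
Proof.
move=> UU hM.
have [x hx] := ultra_bounded_cvg UU (fun t => le_trans (Re_le_normc _) (hM t)).
have [y hy] := ultra_bounded_cvg UU (fun t => le_trans (Im_le_normc _) (hM t)).
exists (x +i* y)%C => e e0; have e20 : 0 < e / 2 by rewrite divr_gt0.
move/cvgrPdist_lt: hx => /(_ _ e20) hx; move/cvgrPdist_lt: hy => /(_ _ e20) hy.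
near=> t; apply: le_lt_trans (normc_le_ReIm _) _.
rewrite [ltRHS](splitr e) ltrD //.
  rewrite raddfB distrC; near: t; exact: hx.
rewrite raddfB distrC; near: t; exact: hy.
Unshelve. all: by end_near.
Qed.

Theorem theorem1p7 (R : realType) (X : completeNormedModType R[i])
    (hX : separable_space X) (Omega : set X) (hOmega : domain Omega)
    (A : Type) (f : A -> X -> R[i]^o)
    (hf : forall a, holomorphic_on Omega (f a))
    (M : R) (hM : forall a z, Omega z -> `|f a z| <= M%:C)
    (K : set X) (hK : compact K) (hKOmega : K `<=` Omega)
    (s : nat -> A) :
  exists phi : nat -> nat,
    {homo phi : m n / (m < n)%N >-> (m < n)%N} /\
    exists g : X -> R[i]^o,
      {uniform K, (fun n : nat => f (s (phi n))) @ \oo --> g}.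
Proof.
have [oO _] := hOmega.
have [U [UU ooU]] := ultraFilterLemma eventually_filter.
(* Pointwise limits along [U]; nothing is asserted about [g] outside [Omega]. *)
have /choice[g gP] : forall z, exists l : R[i], Omega z ->
    forall e, 0 < e -> \forall n \near U, Normc.normc (f (s n) z - l) < e.
  move=> z; have [zO|zO] := pselect (Omega z); last by exists 0.
  have [|l lP] := @ultra_bounded_cvg_complex R nat U (fun n => f (s n) z) M UU.
    by move=> n; rewrite -lecR -norm_normc; exact: hM.
  by exists l.
have Ucvg e : 0 < e ->
    \forall n \near U, K `<=` (fun z => Normc.normc (f (s n) z - g z) <= e).
  move=> e0; have e5 : 0 < e / 5 by rewrite divr_gt0.
  move/compact_near_coveringP: hK.
  move/(_ nat U (fun n z => Normc.normc (f (s n) z - g z) <= e) _); apply => q qK.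
  have qO := hKOmega _ qK.
  have near_q := bounded_holomorphic_equicontinuous M oO qO e5.
  have near_O : \forall y \near q, Omega y by exact: open_nbhs_nbhs.
  exists ([set y | Omega y /\ forall u : X -> R[i]^o, holomorphic_on Omega u ->
      (forall z, Omega z -> `|u z| <= M%:C) -> Normc.normc (u y - u q) <= e / 5],
    [set n | Normc.normc (f (s n) q - g q) < e / 5]) => /=.
    by split; [exact: filterI|exact: gP].
  move=> [y n] /= [[yO yP] nP].
  have [m [my mq]] := filter_ex (filterI (gP y yO _ e5) (gP q qO _ e5)).
  have ny := yP _ (hf (s n)) (hM (s n)); have {}my' := yP _ (hf (s m)) (hM (s m)).
  have -> : f (s n) y - g y = (f (s n) y - f (s n) q) + (f (s n) q - g q)
    - (f (s m) q - g q) - (f (s m) y - f (s m) q) + (f (s m) y - g y) by ring.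
  set a := _ - _ in ny *; set b := _ - _ in nP *; set c := _ - _ in mq *.
  set d := _ - _ in my' *; set k := _ - _ in my *.
  have := le_normcD (a + b - c - d) k; have := le_normcD (a + b - c) (- d).
  have := le_normcD (a + b) (- c); have := le_normcD a b; rewrite !normcN.
  lra.
(* [U] contains every tail of [nat], so each of its members has elements beyond any [N]. *)
have next (k N : nat) : exists n, (N < n)%N /\
    K `<=` (fun z => Normc.normc (f (s n) z - g z) <= k.+1%:R^-1).
  have k0 : 0 < k.+1%:R^-1 :> R by rewrite invr_gt0 ltr0n.
  have largeN : U [set n | (N < n)%N] by apply: ooU; exact: nbhs_infty_gt.
  by have [n [Nn nK]] := filter_ex (filterI largeN (Ucvg _ k0)); exists n.
have /choice[c cP] : forall kN : nat * nat, exists n, (kN.2 < n)%N /\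
    K `<=` (fun z => Normc.normc (f (s n) z - g z) <= kN.1.+1%:R^-1).
  by move=> [k N]; exact: next.
(* Each index is taken beyond the previous one, with accuracy [1 / (k + 1)] at stage [k]. *)
pose phi := fix phi k := if k is j.+1 then c (k, phi j) else c (0%N, 0%N).
have phiK k : K `<=` (fun z => Normc.normc (f (s (phi k)) z - g z) <= k.+1%:R^-1).
  by case: k => [|k]; exact: (cP _).2.
exists phi; split.
  by apply: homo_ltn => [? ? ?|k]; [exact: ltn_trans|exact: (cP (k.+1, phi k)).1].
exists g => P /uniform_nbhs[E [entE EP]].
move: entE; rewrite -entourage_ballE => -[e /= e0 eE].
have /complex_realP[r rE] : e \is Num.real by exact: gtr0_real.
have r0 : 0 < r by move: e0; rewrite rE ltcR.
have := near_infty_natSinv_lt (PosNum r0); apply: filterS => n /= nr.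
apply: EP => z zK; apply: eE; rewrite /= -ball_normE /= rE norm_normc ltcR.
by rewrite normc_dist; apply: le_lt_trans nr; exact: phiK.
Qed.
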